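(* Consider the mixed-binary quadratic program $$v^{P_1}:=\min\{x^\top Qx+2c^\top x:\ Ax=b,\ Gx\le d,\ x_i\in\{0,1\}\ \forall i\in B,\ x\in\mathbb{R}^n_+\},$$ and let $v^{P_2}$ be the optimal value of its slack reformulation, and $v^{\mathrm{SHOR}}$, $v^{\text{SDP-RLT}}$, $v^{\mathrm{DNN}}$ the optimal values of its Shor, SDP-RLT and DNN relaxations (all defined in the context). Then $$v^{\mathrm{SHOR}}\le v^{\mathrm{DNN}}=v^{\text{SDP-RLT}}\le v^{P_1}=v^{P_2}.$$
   Context: Data: $Q\in\mathbb{S}^n$ (real symmetric $n\times n$ matrices), $c\in\mathbb{R}^n$, $A\in\mathbb{R}^{m\times n}$, $G\in\mathbb{R}^{l\times n}$, $b\in\mathbb{R}^m$, $d\in\mathbb{R}^l$, $B\subseteq[n]=\{1,\dots,n\}$ with $|B|=p$. Standing assumption: $A$ has full row rank and $b\ge 0$. All vector and matrix inequalities $\ge,\le$ are entrywise. $\mathbb{S}^k_+$ is the cone of positive semidefinite matrices in $\mathbb{S}^k$; $\mathbb{N}^k$ is the cone of entrywise nonnegative matrices in $\mathbb{R}^{k\times k}$; $\langle U,V\rangle=\mathrm{Tr}(UV^\top)$. For a square matrix $X$, $\operatorname{diag}_B(X)=(X_{ii})_{i\in B}$; for a vector $x$, $x_B=(x_i)_{i\in B}$. ''min'' of a problem denotes its optimal value, i.e. the infimum in $[-\infty,+\infty]$, with value $+\infty$ if the feasible set is empty. Write $Y=\begin{bmatrix} z & x^\top \\ x & X \end{bmatrix}\in\mathbb{S}^{n+1}$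 with $z\in\mathbb{R}$, $x\in\mathbb{R}^n$, $X\in\mathbb{S}^n$, and put $C=\begin{bmatrix} 0 & c^\top \\ c & Q \end{bmatrix}$. Shor relaxation: $v^{\mathrm{SHOR}}:=\min\{\langle C,Y\rangle:\ Y\in\mathcal F_S\cap\mathcal I_S\cap\mathbb{S}^{n+1}_+\}$, where $\mathcal F_S=\{Y\in\mathbb{S}^{n+1}: Ax=b,\ x_i=X_{ii}\ \forall i\in B,\ z=1\}$ and $\mathcal I_S=\{Y\in\mathbb{S}^{n+1}: zd-Gx\ge0,\ x\ge0\}$. SDP-RLT relaxation: $v^{\text{SDP-RLT}}:=\min\{\langle C,Y\rangle:\ Y\in\mathcal F\cap\mathcal I_R\cap\mathbb{S}^{n+1}_+\cap\mathbb{N}^{n+1}\}$, where $\mathcal F=\{Y\in\mathbb{S}^{n+1}: Ax=b,\ AX=bx^\top,\ x_i=X_{ii}\ \forall i\in B,\ z=1\}$, $\mathcal I_R=\{Y\in\mathbb{S}^{n+1}: \mathcal G(Y)\ge0,\ dx^\top-GX\ge0,\ zd-Gx\ge0\}$, and $\mathcal G(Y)=GXG^\top-Gxd^\top-dx^\top G^\top+zdd^\top\in\mathbb{S}^l$. Slack reformulation: with $Q'=\begin{bmatrix} Q & 0_{n\times l} \\ 0_{l\times n} & 0_{l\times l} \end{bmatrix}$, $A'=\begin{bmatrix} A & 0_{m\times l} \\ G & I_l \end{bmatrix}$, $c'=\begin{bmatrix} c \\ 0_{l\times1} \end{bmatrix}$, $b'=\begin{bmatrix} b \\ d \end{bmatrix}$,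 $$v^{P_2}:=\min\{x'^\top Q'x'+2c'^\top x':\ A'x'=b',\ x'_i\in\{0,1\}\ \forall i\in B,\ x'\in\mathbb{R}^{n+l}_+\}.$$ DNN relaxation: with $C'=\begin{bmatrix} 0 & (c')^\top \\ c' & Q' \end{bmatrix}$, $v^{\mathrm{DNN}}:=\min\{\langle C',Y'\rangle:\ Y'\in\mathcal F_D\cap\mathbb{S}^{n+l+1}_+\cap\mathbb{N}^{n+l+1}\}$, where $\mathcal F_D=\left\{\begin{bmatrix} z' & (x')^\top \\ x' & X' \end{bmatrix}\in\mathbb{S}^{n+l+1}: A'x'=b',\ A'X'=b'(x')^\top,\ \operatorname{diag}_B(X')=x'_B,\ z'=1\right\}$ (here $z'\in\mathbb{R}$, $x'\in\mathbb{R}^{n+l}$, $X'\in\mathbb{S}^{n+l}$). *)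

(* Defs.v *)
From HB Require Import structures.
From mathcomp Require Import all_boot all_order all_algebra.
From mathcomp Require Import all_classical all_reals ereal.

Set Implicit Arguments.
Unset Strict Implicit.
Unset Printing Implicit Defensive.

Import Order.TTheory GRing.Theory Num.Theory.

Local Open Scope classical_set_scope.
Local Open Scope ring_scope.

(* Entrywise order; vectors are columns 'cV[R]_k. *)
Definition mxle (R : realType) (p q : nat) (U V : 'M[R]_(p, q)) : Prop :=
  forall i j, U i j <= V i j.

Notation "U <=m V" := (mxle U V) (at level 70, no associativity) : ring_scope.

Definition symmx (R : realType) (k : nat) : set 'M[R]_k := [set U | U^T = U].

Definition psdmx (R : realType) (k : nat) : set 'M[R]_k :=
  [set U | symmx U /\ forall v : 'cV[R]_k, 0 <= (v^T *m U *m v) 0 0].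

Definition nonnegmx (R : realType) (k : nat) : set 'M[R]_k :=
  [set U | 0 <=m U].

Definition mxinner (R : realType) (p q : nat) (U V : 'M[R]_(p, q)) : R :=
  \tr (U *m V^T).

(* The infimum in [-oo, +oo]; it is +oo when S is empty and need not be
   attained. *)
Definition optval (R : realType) (T : Type) (S : set T) (f : T -> R) : \bar R :=
  ereal_inf [set (f y)%:E | y in S].

(* The blocks z, x, X of Y = [z, x^T; x, X]. *)
Definition zpart (R : realType) (k : nat) (Y : 'M[R]_(1 + k)) : R :=
  ulsubmx Y 0 0.
Definition xpart (R : realType) (k : nat) (Y : 'M[R]_(1 + k)) : 'cV[R]_k :=
  dlsubmx Y.
Definition Xpart (R : realType) (k : nat) (Y : 'M[R]_(1 + k)) : 'M[R]_k :=
  drsubmx Y.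

Definition objmx (R : realType) (k : nat) (Q : 'M[R]_k) (c : 'cV[R]_k) :
    'M[R]_(1 + k) :=
  block_mx 0 c^T c Q.

Definition quadobj (R : realType) (k : nat) (Q : 'M[R]_k) (c : 'cV[R]_k)
    (x : 'cV[R]_k) : R :=
  (x^T *m Q *m x) 0 0 + 2 * (c^T *m x) 0 0.

Definition P1_feasible (R : realType) (n m l : nat) (A : 'M[R]_(m, n))
    (G : 'M[R]_(l, n)) (b : 'cV[R]_m) (d : 'cV[R]_l) (B : {set 'I_n}) :
    set 'cV[R]_n :=
  [set x | [/\ A *m x = b, G *m x <=m d,
               forall i, i \in B -> x i 0 = 0 \/ x i 0 = 1 & 0 <=m x]].

Definition v_P1 (R : realType) (n m l : nat) (Q : 'M[R]_n) (c : 'cV[R]_n)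
    (A : 'M[R]_(m, n)) (G : 'M[R]_(l, n)) (b : 'cV[R]_m) (d : 'cV[R]_l)
    (B : {set 'I_n}) : \bar R :=
  optval (P1_feasible A G b d B) (quadobj Q c).

(* Slack data: the index i of the original variables becomes lshift l i. *)
Definition Q_slack (R : realType) (n l : nat) (Q : 'M[R]_n) : 'M[R]_(n + l) :=
  block_mx Q 0 0 0.
Definition c_slack (R : realType) (n l : nat) (c : 'cV[R]_n) : 'cV[R]_(n + l) :=
  col_mx c 0.
Definition A_slack (R : realType) (n m l : nat) (A : 'M[R]_(m, n))
    (G : 'M[R]_(l, n)) : 'M[R]_(m + l, n + l) :=
  block_mx A 0 G 1%:M.
Definition b_slack (R : realType) (m l : nat) (b : 'cV[R]_m) (d : 'cV[R]_l) :
    'cV[R]_(m + l) :=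
  col_mx b d.

Definition P2_feasible (R : realType) (n m l : nat) (A : 'M[R]_(m, n))
    (G : 'M[R]_(l, n)) (b : 'cV[R]_m) (d : 'cV[R]_l) (B : {set 'I_n}) :
    set 'cV[R]_(n + l) :=
  [set x | [/\ A_slack A G *m x = b_slack b d,
               forall i, i \in B ->
                 x (lshift l i) 0 = 0 \/ x (lshift l i) 0 = 1 & 0 <=m x]].

Definition v_P2 (R : realType) (n m l : nat) (Q : 'M[R]_n) (c : 'cV[R]_n)
    (A : 'M[R]_(m, n)) (G : 'M[R]_(l, n)) (b : 'cV[R]_m) (d : 'cV[R]_l)
    (B : {set 'I_n}) : \bar R :=
  optval (P2_feasible A G b d B) (quadobj (Q_slack l Q) (c_slack l c)).

Definition F_S (R : realType) (n m : nat) (A : 'M[R]_(m, n)) (b : 'cV[R]_m)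
    (B : {set 'I_n}) : set 'M[R]_(1 + n) :=
  [set Y | [/\ symmx Y, A *m xpart Y = b,
               forall i, i \in B -> xpart Y i 0 = Xpart Y i i & zpart Y = 1]].

Definition I_S (R : realType) (n l : nat) (G : 'M[R]_(l, n)) (d : 'cV[R]_l) :
    set 'M[R]_(1 + n) :=
  [set Y | [/\ symmx Y, 0 <=m zpart Y *: d - G *m xpart Y & 0 <=m xpart Y]].

Definition v_SHOR (R : realType) (n m l : nat) (Q : 'M[R]_n) (c : 'cV[R]_n)
    (A : 'M[R]_(m, n)) (G : 'M[R]_(l, n)) (b : 'cV[R]_m) (d : 'cV[R]_l)
    (B : {set 'I_n}) : \bar R :=
  optval (F_S A b B `&` I_S G d `&` @psdmx R (1 + n)) (mxinner (objmx Q c)).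

Definition F_R (R : realType) (n m : nat) (A : 'M[R]_(m, n)) (b : 'cV[R]_m)
    (B : {set 'I_n}) : set 'M[R]_(1 + n) :=
  [set Y | [/\ symmx Y, A *m xpart Y = b, A *m Xpart Y = b *m (xpart Y)^T,
               forall i, i \in B -> xpart Y i 0 = Xpart Y i i & zpart Y = 1]].

Definition RLT_GG (R : realType) (n l : nat) (G : 'M[R]_(l, n)) (d : 'cV[R]_l)
    (Y : 'M[R]_(1 + n)) : 'M[R]_l :=
  G *m Xpart Y *m G^T - G *m xpart Y *m d^T - d *m (xpart Y)^T *m G^T
    + zpart Y *: (d *m d^T).

Definition I_R (R : realType) (n l : nat) (G : 'M[R]_(l, n)) (d : 'cV[R]_l) :
    set 'M[R]_(1 + n) :=
  [set Y | [/\ symmx Y, 0 <=m RLT_GG G d Y,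
               0 <=m d *m (xpart Y)^T - G *m Xpart Y &
               0 <=m zpart Y *: d - G *m xpart Y]].

Definition v_SDP_RLT (R : realType) (n m l : nat) (Q : 'M[R]_n) (c : 'cV[R]_n)
    (A : 'M[R]_(m, n)) (G : 'M[R]_(l, n)) (b : 'cV[R]_m) (d : 'cV[R]_l)
    (B : {set 'I_n}) : \bar R :=
  optval (F_R A b B `&` I_R G d `&` @psdmx R (1 + n) `&` @nonnegmx R (1 + n))
    (mxinner (objmx Q c)).

Definition F_D (R : realType) (n m l : nat) (A : 'M[R]_(m, n))
    (G : 'M[R]_(l, n)) (b : 'cV[R]_m) (d : 'cV[R]_l) (B : {set 'I_n}) :
    set 'M[R]_(1 + (n + l)) :=
  [set Y | [/\ symmx Y,
               A_slack A G *m xpart Y = b_slack b d,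
               A_slack A G *m Xpart Y = b_slack b d *m (xpart Y)^T,
               forall i, i \in B ->
                 Xpart Y (lshift l i) (lshift l i) = xpart Y (lshift l i) 0 &
               zpart Y = 1]].

Definition v_DNN (R : realType) (n m l : nat) (Q : 'M[R]_n) (c : 'cV[R]_n)
    (A : 'M[R]_(m, n)) (G : 'M[R]_(l, n)) (b : 'cV[R]_m) (d : 'cV[R]_l)
    (B : {set 'I_n}) : \bar R :=
  optval (F_D A G b d B `&` @psdmx R (1 + (n + l))
            `&` @nonnegmx R (1 + (n + l)))
    (mxinner (objmx (Q_slack l Q) (c_slack l c))).

(* Main.v *)
(* A feasible point of the DNN relaxation is determined by the blocks of its
   original variables: [A' x' = b'] and [A' X' = b' x'^T] force the slack blocks
   to be [d - G x], [d x^T - G X] and [RLT_GG], so that their nonnegativity is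
   exactly the constraints of the SDP-RLT relaxation.  Conversely [M Y M^T] with
   [M = [1, 0; 0, I; d, -G]] fills in the slack blocks and keeps [Y] positive
   semidefinite. *)
Require Import Defs.
From HB Require Import structures.
From mathcomp Require Import all_boot all_order all_algebra.
From mathcomp Require Import all_classical all_reals ereal.

Set Implicit Arguments.
Unset Strict Implicit.
Unset Printing Implicit Defensive.

Import Order.TTheory GRing.Theory Num.Theory.

Local Open Scope ring_scope.

(** The values of [g] on [S'] form a subset of the values of [f] on [S], and a smaller set has a
    larger infimum. Every comparison below reduces to this; attainment plays no part, and an empty
    [S'] gives [+oo]. *)
Lemma le_optval (R : realType) (T U : Type) (S : set T) (S' : set U)
    (f : T -> R) (g : U -> R) :
  (forall y, S' y -> exists2 x, S x & f x = g y) ->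
  (optval S f <= optval S' g)%E.
Proof.
move=> H; apply: ereal_inf_le_tmp => _ [y /H [x Sx <-] <-].
by exists x.
Qed.

(** * Entrywise nonnegativity of products and block matrices *)

Section Nonnegative.
Variable R : realType.

Lemma mx_ge0_subr (p q : nat) (U V : 'M[R]_(p, q)) :
  0 <=m U - V <-> V <=m U.
Proof.
by split=> H i j; have := H i j; rewrite !mxE subr_ge0.
Qed.

Lemma trmx_ge0 (p q : nat) (U : 'M[R]_(p, q)) : 0 <=m U -> 0 <=m U^T.
Proof. by move=> U0 i j; have := U0 j i; rewrite !mxE. Qed.

Lemma mulmx_ge0 (p q r : nat) (U : 'M[R]_(p, q)) (V : 'M[R]_(q, r)) :
  0 <=m U -> 0 <=m V -> 0 <=m U *m V.
Proof.
move=> U0 V0 i j; rewrite !mxE; apply: sumr_ge0 => k _.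
by apply: mulr_ge0; [have := U0 i k | have := V0 k j]; rewrite mxE.
Qed.

Lemma col_mx_ge0 (p q r : nat) (U : 'M[R]_(p, r)) (V : 'M[R]_(q, r)) :
  0 <=m col_mx U V <-> 0 <=m U /\ 0 <=m V.
Proof.
split=> [H|[U0 V0] i j].
  by split=> i j; [have := H (lshift _ i) j | have := H (rshift _ i) j];
    rewrite ?col_mxEu ?col_mxEd !mxE.
by case: (split_ordP i) => k ->; rewrite ?col_mxEu ?col_mxEd mxE;
  [have := U0 k j | have := V0 k j]; rewrite mxE.
Qed.

Lemma row_mx_ge0 (p q r : nat) (U : 'M[R]_(r, p)) (V : 'M[R]_(r, q)) :
  0 <=m row_mx U V <-> 0 <=m U /\ 0 <=m V.
Proof.
rewrite -[row_mx U V]trmxK tr_row_mx.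
have trE p' q' (W : 'M[R]_(p', q')) : 0 <=m W^T <-> 0 <=m W.
  by split=> /trmx_ge0 //; rewrite trmxK.
by rewrite trE col_mx_ge0 !trE.
Qed.

Lemma block_mx_ge0 (p q r s : nat) (U : 'M[R]_(p, r)) (V : 'M[R]_(p, s))
    (W : 'M[R]_(q, r)) (Z : 'M[R]_(q, s)) :
  0 <=m block_mx U V W Z <->
  (0 <=m U /\ 0 <=m V) /\ (0 <=m W /\ 0 <=m Z).
Proof. by rewrite /block_mx col_mx_ge0 !row_mx_ge0. Qed.

End Nonnegative.

(** * Semidefiniteness, and matrices whose corner entry is 1 *)

Section Homogenization.
Variable R : realType.

Lemma psdmx_congr (p q : nat) (M : 'M[R]_(p, q)) (Y : 'M[R]_q) :
  psdmx Y -> psdmx (M *m Y *m M^T).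
Proof.
move=> [Ysym Ypsd]; split=> [|v].
  by rewrite /symmx /= !trmx_mul trmxK Ysym mulmxA.
by have := Ypsd (M^T *m v); rewrite trmx_mul trmxK !mulmxA.
Qed.

(** The quadratic form at [w] is the square of the scalar [v^T w]. *)
Lemma psdmx_rank1 (p : nat) (v : 'cV[R]_p) : psdmx (v *m v^T).
Proof.
split=> [|w]; first by rewrite /symmx /= trmx_mul trmxK.
rewrite mulmxA -mulmxA -[w^T *m v]trmxK trmx_mul trmxK !mxE.
by apply: sumr_ge0 => i _; rewrite mxE -expr2 sqr_ge0.
Qed.

(** Normal form of the feasible points of all the relaxations: [z = 1] and the symmetry of the
    border are built in, so that only [x] and [X] remain. *)
Definition homog_mx (k : nat) (x : 'cV[R]_k) (X : 'M[R]_k) : 'M[R]_(1 + k) :=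
  block_mx 1%:M x^T x X.

Lemma xpart_homog (k : nat) (x : 'cV[R]_k) X : xpart (homog_mx x X) = x.
Proof. by rewrite /xpart block_mxKdl. Qed.

Lemma Xpart_homog (k : nat) (x : 'cV[R]_k) X : Xpart (homog_mx x X) = X.
Proof. by rewrite /Xpart block_mxKdr. Qed.

Lemma zpart_homog (k : nat) (x : 'cV[R]_k) X : zpart (homog_mx x X) = 1.
Proof. by rewrite /zpart block_mxKul mxE. Qed.

Definition homogE := (xpart_homog, Xpart_homog, zpart_homog).

Lemma symmx_homog (k : nat) (x : 'cV[R]_k) X :
  symmx (homog_mx x X) <-> symmx X.
Proof.
rewrite /symmx /= /homog_mx tr_block_mx trmx1 trmxK; split=> [|->//].
by case/eq_block_mx.
Qed.

Lemma homog_partsK (k : nat) (Y : 'M[R]_(1 + k)) :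
  symmx Y -> zpart Y = 1 -> Y = homog_mx (xpart Y) (Xpart Y).
Proof.
move=> Ysym Y1; rewrite /homog_mx /xpart /Xpart -{1}[Y]submxK; congr block_mx.
  by rewrite [ulsubmx Y]mx11_scalar; congr _%:M.
by rewrite trmx_dlsub Ysym.
Qed.

Lemma homog_mx_ge0 (k : nat) (x : 'cV[R]_k) X :
  0 <=m homog_mx x X <-> 0 <=m x /\ 0 <=m X.
Proof.
rewrite block_mx_ge0; split=> [[_ //]|[x0 X0]]; split=> //; split.
  by move=> i j; rewrite !mxE ler0n.
exact: trmx_ge0.
Qed.

Lemma homog_rank1 (k : nat) (x : 'cV[R]_k) :
  homog_mx x (x *m x^T) = col_mx 1%:M x *m (col_mx 1%:M x)^T.
Proof. by rewrite tr_col_mx trmx1 mul_col_row !mulmx1 mul1mx. Qed.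

(** The factor 2 collects the two borders: one gives [c^T x] directly, the other gives the trace of
    [c x^T], which is the same number. *)
Lemma mxinner_homog (k : nat) (Q : 'M[R]_k) (c x : 'cV[R]_k) X :
  mxinner (objmx Q c) (homog_mx x X) = 2 * (c^T *m x) 0 0 + \tr (Q *m X^T).
Proof.
rewrite /mxinner /objmx /homog_mx tr_block_mx trmx1 trmxK mulmx_block.
rewrite mxtrace_block mul0mx add0r [\tr (_ + Q *m _)]raddfD /= addrA.
rewrite [\tr (c *m _)]mxtrace_mulC -[x^T *m c]trmxK mxtrace_tr.
by rewrite trmx_mul trmxK trace_mx11 mulrDl mul1r.
Qed.

Lemma quadobj_homog (k : nat) (Q : 'M[R]_k) (c x : 'cV[R]_k) :
  mxinner (objmx Q c) (homog_mx x (x *m x^T)) = quadobj Q c x.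
Proof.
rewrite mxinner_homog /quadobj addrC trmx_mul trmxK mulmxA mxtrace_mulC.
by rewrite mulmxA trace_mx11.
Qed.

(** The zero blocks of [Q_slack] and [c_slack] annihilate all slack blocks. *)
Lemma mxinner_slack (n l : nat) (Q : 'M[R]_n) (c x : 'cV[R]_n) (s : 'cV[R]_l)
    (X : 'M[R]_n) X12 X21 X22 :
  mxinner (objmx (Q_slack l Q) (c_slack l c))
    (homog_mx (col_mx x s) (block_mx X X12 X21 X22)) =
  mxinner (objmx Q c) (homog_mx x X).
Proof.
rewrite !mxinner_homog /Q_slack /c_slack tr_col_mx mul_row_col trmx0 mul0mx.
by rewrite tr_block_mx mulmx_block mxtrace_block !mul0mx !addr0 mxtrace0 addr0.
Qed.

End Homogenization.

(** * The lift to slack variables and its inverse *)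

Section Slack.
Variables (R : realType) (n m l : nat).
Variables (A : 'M[R]_(m, n)) (G : 'M[R]_(l, n)).
Variables (b : 'cV[R]_m) (d : 'cV[R]_l) (B : {set 'I_n}).

(** The upper right block is written with [X G^T], not as a transpose of the lower left one, so that
    the congruence formula [slack_liftE] holds for every [X]. *)
Definition slack_lift (x : 'cV[R]_n) (X : 'M[R]_n) : 'M[R]_(1 + (n + l)) :=
  homog_mx (col_mx x (d - G *m x))
    (block_mx X (x *m d^T - X *m G^T) (d *m x^T - G *m X)
       (RLT_GG G d (homog_mx x X))).

Lemma slack_liftE (x : 'cV[R]_n) (X : 'M[R]_n)
    (M := block_mx 1%:M 0 (col_mx 0 d) (col_mx 1%:M (- G))
       : 'M[R]_(1 + (n + l), 1 + n)) :
  slack_lift x X = M *m homog_mx x X *m M^T.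
Proof.
rewrite /M /slack_lift /RLT_GG !homogE scale1r /homog_mx.
rewrite tr_block_mx !mulmx_block !tr_col_mx !trmx0 !trmx1.
rewrite !(mul0mx, mul1mx, mulmx0, mulmx1, addr0, add0r).
rewrite !(mul_col_mx, mul_mx_row, mul_col_row, add_col_mx, add_row_mx).
rewrite !(mul0mx, mul1mx, mulmx0, mulmx1, addr0, add0r, mulNmx).
(* The lower right corner is a sum of two products; both are put in block form and added
   blockwise. *)
rewrite -/(block_mx 0 _ 0 _) -block_mxEh add_block_mx !add0r.
rewrite [(- G)^T]linearN /= !mulmxN.
congr (block_mx _ (row_mx _ _) _ (block_mx _ _ _ _)).
- by rewrite linearB /= trmx_mul.
rewrite !mulmxBl opprB.
by rewrite [LHS](ACl (4*2*(1*3))).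
Qed.

Lemma psdmx_slack_lift (x : 'cV[R]_n) (X : 'M[R]_n) :
  psdmx (slack_lift x X) <-> psdmx (homog_mx x X).
Proof.
split=> [H|]; last by rewrite slack_liftE; exact: psdmx_congr.
(* This matrix selects the first [1 + n] coordinates, so the congruence extracts the principal
   submatrix [homog_mx x X]. *)
have := psdmx_congr (block_mx 1%:M 0 0 (row_mx 1%:M 0) : 'M_(1 + n, _)) H.
rewrite /slack_lift /homog_mx tr_block_mx !mulmx_block tr_row_mx !trmx0 !trmx1.
rewrite !(mul0mx, mul1mx, mulmx0, mulmx1, addr0, add0r) !tr_col_mx.
rewrite mul_row_col mul_row_block.
rewrite !(mul0mx, mul1mx, mulmx0, mulmx1, addr0, add0r).
by rewrite !mul_row_col !(mulmx0, mulmx1, addr0) mul0mx mul1mx addr0.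
Qed.

Lemma slack_lift_ge0 (x : 'cV[R]_n) (X : 'M[R]_n) : symmx X ->
  0 <=m slack_lift x X <->
  I_R G d (homog_mx x X) /\ 0 <=m homog_mx x X.
Proof.
move=> Xsym; rewrite /I_R /= !homogE scale1r !homog_mx_ge0 col_mx_ge0.
rewrite block_mx_ge0; split.
  move=> [[x0 s0] [[X0 _] [X21_ge0 X22_ge0]]]; do 2!split=> //.
  exact/symmx_homog.
move=> [[_ X22_ge0 X21_ge0 s0] [x0 X0]]; do 3!split=> //.
(* The block still missing, [x d^T - X G^T], is the transpose of [d x^T - G X] because [X] is
   symmetric. *)
have := trmx_ge0 X21_ge0.
by rewrite linearB /= !trmx_mul trmxK Xsym.
Qed.

(** The rows of [A_slack] coming from [G] hold by the choice of the slack blocks. Those coming from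
    [A] follow from [A x = b] and [A X = b x^T], which give [A (x d^T - X G^T) = b (d - G x)^T]. *)
Lemma F_D_slack_lift (x : 'cV[R]_n) (X : 'M[R]_n) :
  F_R A b B (homog_mx x X) -> F_D A G b d B (slack_lift x X).
Proof.
rewrite /F_R /F_D /= /slack_lift !homogE.
move=> [/symmx_homog Xsym Axb AXb XB _]; split=> //.
- apply/symmx_homog; rewrite /symmx /= tr_block_mx Xsym /RLT_GG !homogE scale1r.
  congr block_mx; rewrite !(linearB, linearD) /= !trmx_mul
    !trmxK ?Xsym ?mulmxA //.
  by congr (_ + _); rewrite addrAC.
- rewrite /A_slack /b_slack mul_block_col mul0mx addr0 mul1mx Axb.
  by rewrite addrC subrK.
- rewrite /A_slack /b_slack /RLT_GG !homogE scale1r tr_col_mx mul_col_row.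
  rewrite mulmx_block !mul0mx !mul1mx !addr0 AXb; congr block_mx.
  + by rewrite [in RHS]linearB /= trmx_mul !mulmxBr !mulmxA AXb Axb.
  + by rewrite addrC subrK.
  + rewrite [in RHS]linearB /= trmx_mul !mulmxBr !mulmxA.
    by rewrite -opprB -addrA addKr addrC.
- by move=> i iB; rewrite block_mxEul col_mxEu XB.
Qed.

(** The identity block of [A_slack] lets the rows of [G] be solved for [s], [X21] and [X22];
    symmetry then yields [X12] from [X21]. *)
Lemma F_D_inv (Y : 'M[R]_(1 + (n + l))) : F_D A G b d B Y ->
  exists x X, Y = slack_lift x X /\ F_R A b B (homog_mx x X).
Proof.
move=> [Ysym + + + Y1]; move: (Ysym).
rewrite (homog_partsK Ysym Y1) symmx_homog !homogE.
move: (xpart Y) (Xpart Y) => x' X'.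
rewrite -[x']vsubmxK -[X']submxK.
move: (usubmx x') (dsubmx x') => x s.
move: (ulsubmx X') (ursubmx X') (dlsubmx X') (drsubmx X') => X X12 X21 X22.
rewrite /symmx /= tr_block_mx => /eq_block_mx [Xsym X12E _ _].
rewrite /A_slack /b_slack mul_block_col mul0mx addr0 mul1mx.
move=> /eq_col_mx [Axb sE].
rewrite tr_col_mx mul_col_row mulmx_block !mul0mx !mul1mx !addr0.
move=> /eq_block_mx [AXb _ X21E X22E] XB.
have {}sE : s = d - G *m x by rewrite -sE addrC addKr.
have {}X21E : X21 = d *m x^T - G *m X by rewrite -X21E addrC addKr.
have {}X12E : X12 = x *m d^T - X *m G^T.
  by rewrite -X12E X21E linearB /= !trmx_mul trmxK Xsym.
exists x, X; split.
  rewrite /slack_lift; congr (homog_mx (col_mx _ _) (block_mx _ _ _ _)) => //.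
  have -> : X22 = d *m s^T - G *m X12 by rewrite -X22E addrC addKr.
  rewrite /RLT_GG !homogE scale1r sE X12E [(d - _)^T]linearB /= trmx_mul.
  rewrite !mulmxBr !mulmxA opprB.
  by rewrite [RHS](ACl ((4*3)*(1*2))).
rewrite /F_R /= !homogE; split=> // [|i /XB]; first exact/symmx_homog.
by rewrite block_mxEul col_mxEu.
Qed.

End Slack.

(** * Comparison of the five optimal values *)

Theorem theorem1 (R : realType) (n m l : nat)
    (Q : 'M[R]_n) (c : 'cV[R]_n) (A : 'M[R]_(m, n)) (G : 'M[R]_(l, n))
    (b : 'cV[R]_m) (d : 'cV[R]_l) (B : {set 'I_n})
    (Qsym : symmx Q) (Afull : row_free A) (b_ge0 : 0 <=m b) :
  [/\ (v_SHOR Q c A G b d B <= v_DNN Q c A G b d B)%E,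
      v_DNN Q c A G b d B = v_SDP_RLT Q c A G b d B,
      (v_SDP_RLT Q c A G b d B <= v_P1 Q c A G b d B)%E &
      v_P1 Q c A G b d B = v_P2 Q c A G b d B].
Proof.
have DNN_RLT : v_DNN Q c A G b d B = v_SDP_RLT Q c A G b d B.
  apply/le_anti/andP; split; apply: le_optval => Y.
  - move=> [[[FY IY] PY] NY]; have [Ysym _ _ _ Y1] := FY.
    move: FY IY PY NY; rewrite (homog_partsK Ysym Y1) => FY IY PY NY.
    exists (slack_lift G d (xpart Y) (Xpart Y)); last exact: mxinner_slack.
    have Xsym : symmx (Xpart Y).
      by apply/(symmx_homog (xpart Y)); case: FY.
    do 2?split; first exact: F_D_slack_lift.
      exact/psdmx_slack_lift.
    by apply/slack_lift_ge0.
  (* Conversely, a DNN point is already a lift, and the blocks it lifts are feasible for SDP-RLT. *)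
  - move=> [[/F_D_inv [x [X [-> FY]]] /psdmx_slack_lift PY]].
    have Xsym : symmx X by apply/(symmx_homog x); case: FY.
    move=> /(slack_lift_ge0 _ _ _ Xsym) [IY NY].
    by exists (homog_mx x X); last by rewrite mxinner_slack.
have P1_sub_slack x : P1_feasible A G b d B x ->
    P2_feasible A G b d B (col_mx x (d - G *m x)).
  move=> [Axb Gxd xB x0]; split.
  - rewrite /A_slack /b_slack mul_block_col mul0mx addr0 mul1mx Axb.
    by rewrite addrC subrK.
  - by move=> i /xB; rewrite col_mxEu.
  - by apply/col_mx_ge0; split=> //; apply/mx_ge0_subr.
have quadobj_slack (x : 'cV[R]_n) (s : 'cV[R]_l) :
    quadobj (Q_slack l Q) (c_slack l c) (col_mx x s) = quadobj Q c x.
  by rewrite -!quadobj_homog tr_col_mx mul_col_row mxinner_slack.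
split=> //.
(* After passing to SDP-RLT both problems live in the same space, and [Y] itself is Shor feasible:
   [x >= 0] is read off from the border of the nonnegative [Y]. *)
- rewrite DNN_RLT; apply: le_optval => Y [[[FY IY] PY] NY].
  exists Y => //; split=> //; move: FY IY NY => [Ysym Axb _ XB Y1] [_ _ _ s0].
  rewrite {1}(homog_partsK Ysym Y1) => /homog_mx_ge0 [x0 _].
  by split.
- apply: le_optval => x [Axb Gxd xB x0].
  (* The rank-one lift of [x]: with [s = d - G x], the RLT blocks become [s s^T] and [s x^T], and
     the diagonal condition becomes [x_i = x_i^2], true for 0 and 1. *)
  exists (homog_mx x (x *m x^T)); last exact: quadobj_homog.
  have s0 : 0 <=m d - G *m x by apply/mx_ge0_subr.
  have xxsym : symmx (x *m x^T) by rewrite /symmx /= trmx_mul trmxK.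
  have x2 : 0 <=m homog_mx x (x *m x^T).
    by apply/homog_mx_ge0; split=> //; exact/mulmx_ge0/trmx_ge0.
  split=> //; split; last by rewrite homog_rank1; exact: psdmx_rank1.
  split; rewrite /F_R /I_R /= /RLT_GG !homogE ?scale1r; split=> //; try exact/symmx_homog.
  + by rewrite mulmxA Axb.
  + move=> i /xB; rewrite !mxE big_ord1 !mxE.
    by case=> ->; rewrite ?mulr0 ?mulr1.
  + have := mulmx_ge0 s0 (trmx_ge0 s0).
    rewrite linearB /= trmx_mul !mulmxBl !mulmxBr !mulmxA.
    by rewrite opprB [X in _ -> _ <=m X](ACl ((4*3)*(1*2))).
  + by rewrite mulmxA -mulmxBl; exact/mulmx_ge0/trmx_ge0.
- apply/le_anti/andP; split; apply: le_optval.
  (* Dropping the slack part [s] of a point of the slack problem leaves [y] with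
     [d - G y = s >= 0]. *)
  + move=> x; rewrite -[x]vsubmxK; move: (usubmx x) (dsubmx x) => y s.
    rewrite quadobj_slack; move=> [+ yB /col_mx_ge0 [y0 s0]].
    rewrite /A_slack /b_slack mul_block_col mul0mx addr0 mul1mx.
    move=> /eq_col_mx [Ayb <-]; exists y => //; split=> //.
    * by apply/mx_ge0_subr; rewrite addrC addKr.
    * by move=> i /yB; rewrite col_mxEu.
  + by move=> x /P1_sub_slack; exists (col_mx x (d - G *m x)).
Qed.
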